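(* Let $P=P^X$ be a probability measure over $\mathbb{R}^k$ and fix $\theta\in\mathbb{R}^k$. Then, for any shape matrix $V\in\mathcal{P}_{k,\mathrm{tr}}$, any invertible $k\times k$ matrix $A$, any $k$-vector $b$ (and any $\alpha$), $$D_{A\theta+b}(V_A,P^{AX+b})=D_\theta(V,P^X),\qquad R_{A\theta+b}(\alpha,P^{AX+b})=\{V_A: V\in R_\theta(\alpha,P^X)\},$$ where $V_A=kAVA^T/\mathrm{tr}(AVA^T)$ is the shape matrix proportional to $AVA^T$.
   Context: $P^Y$ denotes the distribution of a random $k$-vector $Y$, and $\mathrm{pr}$ denotes probability. $\mathcal{P}_k$ is the set of $k\times k$ real symmetric positive definite matrices, $A^{1/2}$ is the unique square root of $A\in\mathcal{P}_k$ in $\mathcal{P}_k$, $A^{-1/2}$ is the inverse of $A^{1/2}$, and $\mathcal{P}_{k,\mathrm{tr}}=\{V\in\mathcal{P}_k:\mathrm{tr}(V)=k\}$ is the set of shape matrices. $\mathcal{S}^{m-1}$ is the unit sphere of $\mathbb{R}^m$. For a probability measure $P=P^X$ over $\mathbb{R}^k$, $\theta\in\mathbb{R}^k$ and $V\in\mathcal{P}_{k,\mathrm{tr}}$, let $U_{\theta,V}=V^{-1/2}(X-\theta)/\|V^{-1/2}(X-\theta)\|$ if $X\neq\theta$ and $U_{\theta,V}=0$ otherwise, and let $W_{\theta,V}=\mathrm{vec}\{U_{\theta,V}U_{\theta,V}^T-(1/k)I_k\}\in\mathbb{R}^{k^2}$, where $\mathrm{vec}$ stacks the columns of a matrix. The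 fixed-$\theta$ (Tyler) shape depth of $V$ with respect to $P$ is $$D_\theta(V,P)=\inf_{u\in\mathcal{S}^{k^2-1}}\mathrm{pr}(u^T W_{\theta,V}\geq 0),$$ and the corresponding depth regions are $R_\theta(\alpha,P)=\{V\in\mathcal{P}_{k,\mathrm{tr}}: D_\theta(V,P)\geq\alpha\}$. *)

(* Defs.v *)
From HB Require Import structures.
From mathcomp Require Import all_boot all_order all_algebra.
From mathcomp Require Import all_classical all_reals all_analysis.

Set Implicit Arguments.
Unset Strict Implicit.
Unset Printing Implicit Defensive.

Import Order.TTheory GRing.Theory Num.Theory.
Import numFieldNormedType.Exports.

Local Open Scope classical_set_scope.
Local Open Scope ring_scope.

(* R^k (column vectors) with its Borel sigma-algebra, generated by the open
   sets of the product topology of 'cV[R]_k. *)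
Definition Rvec (R : realType) (k : nat) := g_sigma_algebraType (@open 'cV[R]_k).

Definition affine (R : realType) (k : nat) (A : 'M[R]_k) (b x : Rvec R k) :
  Rvec R k := A *m (x : 'cV[R]_k) + (b : 'cV[R]_k).

Lemma continuous_affine (R : realType) (k : nat) (A : 'M[R]_k) (b : 'cV[R]_k) :
  continuous (affine A b : 'cV[R]_k -> 'cV[R]_k).
Proof.
move=> x; have FF : Filter (nbhs x) := nbhs_filter x.
apply/cvg_ballP => e e0.
have cf i j : (fun y : 'cV[R]_k => affine A b y i j) y @[y --> x] -->
    affine A b x i j.
  rewrite /affine !mxE.
  under eq_fun do rewrite !mxE.
  apply: cvgD; last exact: cvg_cst.
  apply: cvg_big => [|l _]; first exact: add_continuous.
  by apply: cvgM; [exact: cvg_cst|exact: coord_continuous].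
have H : \forall y \near x, forall ij : 'I_k * 'I_1,
    ball (affine A b x ij.1 ij.2) e (affine A b y ij.1 ij.2).
  apply: (@filter_forall _ _ (fun ij y =>
    ball (affine A b x ij.1 ij.2) e (affine A b y ij.1 ij.2)) _ FF) => ij.
  by have /cvg_ballP/(_ e e0) := cf ij.1 ij.2.
near=> y; split => // i j.
by have /(_ (i, j)) : forall ij : 'I_k * 'I_1,
  ball (affine A b x ij.1 ij.2) e (affine A b y ij.1 ij.2) by near: y.
Unshelve. all: by end_near. Qed.

Lemma measurable_affine (R : realType) (k : nat) (A : 'M[R]_k) (b : 'cV[R]_k) :
  measurable_fun [set: Rvec R k] (affine A b).
Proof.
apply: (@measurability _ _ (Rvec R k) (Rvec R k) setT (affine A b)
  (@open 'cV[R]_k)) => //.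
move=> _ [B oB <-]; rewrite setTI; apply: sub_sigma_algebra.
by move/continuousP: (@continuous_affine R k A b) => /(_ B oB).
Qed.

HB.instance Definition _ (R : realType) (k : nat) (A : 'M[R]_k)
    (b : 'cV[R]_k) :=
  isMeasurableFun.Build _ _ _ _ (affine A b) (measurable_affine A b).

Section depth.
Context {R : realType} {k : nat}.
Implicit Types (A V M : 'M[R]_k) (theta : 'cV[R]_k).

Definition posdefmx M : Prop :=
  M \is symmetricmx /\
  forall x : 'cV[R]_k, x != 0 -> 0 < (x^T *m M *m x) 0 0.

(* The square root of M in the set of symmetric positive definite matrices,
   which exists and is unique when M is itself in that set (0 otherwise). *)
Definition sqrtmx M : 'M[R]_k :=
  xget 0 [set B : 'M[R]_k | posdefmx B /\ B *m B = M].

Definition shape_matrices : set 'M[R]_k :=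
  [set V | posdefmx V /\ \tr V = k%:R].

(* Euclidean norm; the library norm of a matrix is the maximum norm. *)
Definition enorm (n : nat) (x : 'cV[R]_n) : R :=
  Num.sqrt (\sum_i x i 0 ^+ 2).

Definition unit_sphere (n : nat) : set 'cV[R]_n := [set u | enorm u = 1].

(* mxvec reads a matrix row by row, hence the transposition. *)
Definition vec_cols M : 'cV[R]_(k * k) := (mxvec M^T)^T.

Definition Usign theta V (x : 'cV[R]_k) : 'cV[R]_k :=
  let y := invmx (sqrtmx V) *m (x - theta) in
  if x == theta then 0 else (enorm y)^-1 *: y.

Definition Wvec theta V (x : 'cV[R]_k) : 'cV[R]_(k * k) :=
  let U := Usign theta V x in vec_cols (U *m U^T - (k%:R^-1)%:M).

Definition depth theta V (P : probability (Rvec R k) R) : \bar R :=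
  ereal_inf [set P [set x : Rvec R k | 0 <= (u^T *m Wvec theta V x) 0 0]
            | u in @unit_sphere (k * k)].

Definition depth_region theta (alpha : R) (P : probability (Rvec R k) R) :
  set 'M[R]_k :=
  [set V | shape_matrices V /\ (alpha%:E <= depth theta V P)%E].

Definition shape_transform A V : 'M[R]_k :=
  (k%:R / \tr (A *m V *m A^T)) *: (A *m V *m A^T).

End depth.

(* Main.v *)
Require Import Defs.
From HB Require Import structures.
From mathcomp Require Import all_boot all_order all_algebra.
From mathcomp Require Import complex.
From mathcomp Require Import all_classical all_reals all_analysis.

Set Implicit Arguments.
Unset Strict Implicit.
Unset Printing Implicit Defensive.

Import Order.TTheory GRing.Theory Num.Theory.
Import numFieldNormedType.Exports.

Local Open Scope classical_set_scope.
Local Open Scope ring_scope.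

(** Put [B1] and [B2] for the square roots of [V] and of its transform
    [V_A = c *: (A V A^T)], where [c = k / tr (A V A^T)]. Since [B2 B2 = V_A]
    and [B1 B1 = V], the matrix [M = B2^-1 A B1] satisfies
    [M M^T = c^-1 I], so [Q = c^(1/2) M] is orthogonal. As
    [B2^-1 (A x + b - (A theta + b)) = M (B1^-1 (x - theta))], normalization
    shows that the sign vector of [A x + b] with respect to [A theta + b] and
    [V_A] is [Q U], where [U] is that of [x] with respect to [theta] and [V]
    ([Usign_equivariant]). Therefore the matrix [U U^T - I/k] is conjugated by
    [Q] ([Wvec_equivariant]). Conjugation by [Q] is an isometric bijection of
    the matrices with the Frobenius inner product, which is the dot product of
    the stacked columns; it permutes the unit directions [u] over which the
    depth takes its infimum, so the depth is unchanged
    ([depth_equivariant]). The statement on regions follows because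
    [V |-> V_A] is onto the shape matrices, with the transform by [A^-1] as a
    right inverse ([shape_transformVK]).

    The argument uses that every positive definite [N] has a positive definite
    square root ([posdefmx_sqrt_exists]), but not that it is unique. By the
    spectral theorem over [R[i]], a real polynomial that vanishes at the
    eigenvalues of [N], which are real, annihilates [N]
    ([symmetric_horner_mx0]). The eigenvalues are positive; if [q] interpolates
    their fourth roots, then [q(N)] is real symmetric with [q(N)^4 = N], and
    [q(N)^2] is the desired root. *)

(** * Polynomials in a real symmetric matrix *)

Lemma symmetricmxP (F : fieldType) (n : nat) (M : 'M[F]_n) :
  reflect (M^T = M) (M \is symmetricmx).
Proof.
by rewrite is_hermitianmxE expr0 scale1r map_mx_id //; apply: (iffP eqP).
Qed.

Lemma trmx_horner_mx (F : comNzRingType) (n : nat) (M : 'M[F]_n.+1)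
    (p : {poly F}) :
  (horner_mx M p)^T = horner_mx M^T p.
Proof.
elim/poly_ind: p => [|p c IH]; first by rewrite !rmorph0 trmx0.
rewrite !rmorphD /= !rmorphM /= !horner_mx_X !horner_mx_C linearD /=.
rewrite tr_scalar_mx.
by rewrite -!mulmxE trmx_mul IH (comm_mx_horner _ (comm_mx_refl _)).
Qed.

Lemma exists_interpolant (F : fieldType) (f : F -> F) (s : seq F) :
  exists p : {poly F}, {in s, forall r, p.[r] = f r}.
Proof.
elim: s => [|a s [p hp]]; first by exists 0.
have [as_|as_] := boolP (a \in s).
  by exists p => r; rewrite inE => /orP[/eqP->|]; exact: hp.
pose w := \prod_(r <- s) ('X - r%:P).
have wa : w.[a] != 0 by rewrite -/(root w a) root_prod_XsubC.
exists (p + ((f a - p.[a]) / w.[a])%:P * w) => r.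
rewrite inE hornerD hornerM hornerC => /orP[/eqP->|rs].
  by rewrite divfK // addrC subrK.
have /rootP -> : root w r by rewrite root_prod_XsubC.
by rewrite mulr0 addr0 hp.
Qed.

(** A form of the spectral theorem: the minimal polynomial of a real symmetric
    matrix is a product of distinct real linear factors. The entries of [s] are
    the diagonal entries of a diagonalization over the complex numbers. *)
Lemma symmetric_horner_mx0 (R : rcfType) (n : nat) (M : 'M[R]_n.+1) :
  M \is symmetricmx ->
  exists2 s : seq R, {in s, forall r, eigenvalue M r} &
    forall p : {poly R}, {in s, forall r, p.[r] = 0} -> horner_mx M p = 0.
Proof.
move=> /symmetricmxP symM.
pose MC := map_mx (real_complex R) M.
have hermM : MC \is hermsymmx.
  apply: realsym_hermsym; first by apply/symmetricmxP; rewrite map_trmx symM.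
  by apply/mxOverP => i j; rewrite mxE; apply/complex_realP; exists (M i j).
have /orthomx_spectralP MCE := hermitian_normalmx hermM.
set P := spectralmx MC in MCE; set D := spectral_diag MC in MCE.
have Punit : P \in unitmx by exact: spectral_unit.
pose d i := complex.Re (D 0 i).
have dE i : real_complex R (d i) = D 0 i.
  apply: RRe_real.
  by have /mxOverP/(_ 0 i) := hermitian_spectral_diag_real hermM.
exists [seq d i | i <- enum 'I_n.+1].
  (* The i-th row of P is an eigenvector for the eigenvalue D 0 i. *)
  move=> _ /mapP[i _ ->].
  rewrite eigenvalue_root_char -(fmorph_root (real_complex R)) map_char_poly.
  rewrite -eigenvalue_root_char.
  apply/eigenvalueP; exists (row i P).
    rewrite -/MC MCE -row_mul !mulmxA mulmxV // mul1mx row_mul row_diag_mx.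
    by rewrite -scalemxAl -rowE -dE.
  apply: contraTneq Punit => Pi0; rewrite -row_free_unit.
  apply: contraL (oner_neq0 (complex R)) => /row_freeP[Q /row_matrixP/(_ i)].
  rewrite row_mul Pi0 mul0mx row1 => /rowP/(_ i).
  by rewrite !mxE !eqxx => ->; rewrite negbK.
move=> p p0; apply: (map_mx_inj (f := real_complex R)); rewrite map_mx0.
rewrite map_horner_mx -/MC MCE horner_mx_uconjC // horner_mx_diag.
suff -> : map_mx (horner (map_poly (real_complex R) p)) D = 0.
  by rewrite linear0 mulmx0 mul0mx.
apply/rowP => i; rewrite !mxE -dE horner_map /= p0 ?rmorph0 //.
by apply: map_f; rewrite mem_enum.
Qed.

(** * Positive definite matrices *)

Section posdef.
Variables (R : realType) (k : nat).
Implicit Types A M : 'M[R]_k.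

Lemma posdefmx_sym M : posdefmx M -> M^T = M.
Proof. by case=> /symmetricmxP. Qed.

Lemma dotmx_gt0 n (x : 'cV[R]_n) : x != 0 -> 0 < (x^T *m x) 0 0.
Proof.
move=> x0; rewrite mxE; have [i xi] : exists i, x i 0 != 0.
  apply/existsP; apply: contraNT x0 => /existsPn h; apply/eqP/colP => i.
  by rewrite [RHS]mxE; apply/eqP; rewrite -[_ == _]negbK h.
rewrite (bigD1 i) //= mxE ltr_pwDl //; last first.
  by apply: sumr_ge0 => j _; rewrite mxE -expr2 sqr_ge0.
by rewrite -expr2 lt_def sqr_ge0 sqrf_eq0 xi.
Qed.

Lemma posdefmx_unit M : posdefmx M -> M \in unitmx.
Proof.
case=> _ pM; rewrite -row_free_unit -kermx_eq0.
apply/rowV0P => v /sub_kermxP vM.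
apply/eqP; apply: contraT => v0; have := pM v^T; rewrite trmx_eq0 => /(_ v0).
by rewrite trmxK vM mul0mx mxE ltxx.
Qed.

Lemma posdefmx_congr A M : A \in unitmx -> posdefmx M ->
  posdefmx (A *m M *m A^T).
Proof.
move=> uA pM; have [_ hM] := pM; split.
  by apply/symmetricmxP; rewrite !trmx_mul trmxK (posdefmx_sym pM) mulmxA.
move=> x x0; have := hM (A^T *m x); rewrite trmx_mul trmxK !mulmxA; apply.
have uAt : A^T \in unitmx by rewrite unitmx_tr.
by apply: contraNneq x0 => Ax0; rewrite -(mulKmx uAt x) Ax0 mulmx0.
Qed.

Lemma posdefmxZ (c : R) M : 0 < c -> posdefmx M -> posdefmx (c *: M).
Proof.
move=> c0 [/symmetricmxP symM pM]; split.
  by apply/symmetricmxP; rewrite linearZ /= symM.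
by move=> x x0; rewrite -scalemxAr -scalemxAl mxE mulr_gt0 // pM.
Qed.

Lemma posdefmx_tr_gt0 M : (0 < k)%N -> posdefmx M -> 0 < \tr M.
Proof.
move=> k0 [_ pM].
have Mii i : 0 < M i i.
  have := pM (delta_mx i 0); rewrite trmx_delta -rowE -colE !mxE; apply.
  by apply/eqP => /colP/(_ i)/eqP; rewrite !mxE !eqxx oner_eq0.
rewrite /mxtrace (bigD1 (Ordinal k0)) //= ltr_pwDl //.
by apply: sumr_ge0 => i _; exact/ltW.
Qed.

End posdef.

Lemma posdefmx_sqrt_exists (R : realType) (k : nat) (M : 'M[R]_k) :
  posdefmx M -> exists B, posdefmx B /\ B *m B = M.
Proof.
case: k M => [|n] M pM; first by exists M; rewrite [LHS]flatmx0 [RHS]flatmx0.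
have [s eigs annih] := symmetric_horner_mx0 pM.1.
have s_ge0 r : r \in s -> 0 <= r.
  move=> /eigs/eigenvalueP[v vM v0].
  have := pM.2 v^T; rewrite trmx_eq0 => /(_ v0).
  rewrite trmxK vM -scalemxAl mxE => h; apply: ltW; move: h.
  by rewrite pmulr_lgt0 // -[v in v *m _]trmxK dotmx_gt0 ?trmx_eq0.
(* B is the square of the symmetric matrix Q, a fourth root of M; this makes
   B positive definite. *)
have [q qE] := exists_interpolant (fun r => Num.sqrt (Num.sqrt r)) s.
pose Q := horner_mx M q.
have symQ : Q^T = Q by rewrite trmx_horner_mx posdefmx_sym.
have Q4 : Q *m Q *m (Q *m Q) = M.
  apply/eqP; rewrite -subr_eq0 -[X in _ - X]horner_mx_X !mulmxE.
  rewrite -!rmorphM -rmorphB.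
  apply/eqP; apply: annih => r rs.
  rewrite hornerD hornerN hornerX !hornerM qE // -!expr2.
  by rewrite !sqr_sqrtr ?sqrtr_ge0 ?s_ge0 // subrr.
exists (Q *m Q); split=> //; split.
  by apply/symmetricmxP; rewrite trmx_mul symQ.
move=> x x0; rewrite -{1}symQ !mulmxA -mulmxA -trmx_mul dotmx_gt0 //.
apply: contraNneq x0 => Qx0; apply/eqP.
rewrite -(mulKmx (posdefmx_unit pM) x) -{2}Q4.
by rewrite -!mulmxA Qx0 !mulmx0.
Qed.

Lemma sqrtmxP (R : realType) (k : nat) (M : 'M[R]_k) :
  posdefmx M -> posdefmx (sqrtmx M) /\ sqrtmx M *m sqrtmx M = M.
Proof.
move=> /posdefmx_sqrt_exists[B hB]; rewrite /sqrtmx.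
by case: xgetP => // /(_ B).
Qed.

(** * The affine action on shape matrices *)

Section shape.
Variables (R : realType) (k : nat).
Implicit Types A V : 'M[R]_k.

Lemma shape_transform_factor_gt0 A V : (0 < k)%N -> A \in unitmx ->
  posdefmx V -> 0 < k%:R / \tr (A *m V *m A^T) :> R.
Proof.
move=> k0 uA pV; rewrite divr_gt0 ?ltr0n // posdefmx_tr_gt0 //.
exact: posdefmx_congr.
Qed.

Lemma shape_transform_posdef A V : A \in unitmx -> posdefmx V ->
  posdefmx (shape_transform A V).
Proof.
have [k0 uA pV|] := ltnP 0 k.
  apply: posdefmxZ; first exact: shape_transform_factor_gt0.
  exact: posdefmx_congr.
case: k A V => // A V _ uA pV.
by rewrite (_ : shape_transform A V = V) // [LHS]flatmx0 [RHS]flatmx0.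
Qed.

Lemma shape_transform_shape A V : A \in unitmx -> shape_matrices V ->
  shape_matrices (shape_transform A V).
Proof.
move=> uA [pV _]; split; first exact: shape_transform_posdef.
have [k0|] := ltnP 0 k; last first.
  by case: k A V uA pV => // *; rewrite /mxtrace big_ord0.
rewrite linearZ /= divfK // gt_eqF // posdefmx_tr_gt0 //.
exact: posdefmx_congr.
Qed.

(** The composite only rescales [V], by a factor that must be 1 because
    [tr V = k]. *)
Lemma shape_transformVK A V : A \in unitmx -> shape_matrices V ->
  shape_transform A (shape_transform (invmx A) V) = V.
Proof.
move=> uA [pV trV].
have [k0|] := ltnP 0 k; last first.
  by case: k A V uA pV trV => // A V *; rewrite [LHS]flatmx0 [RHS]flatmx0.
have kn0 : k%:R != 0 :> R by rewrite pnatr_eq0 -lt0n.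
have c0 := shape_transform_factor_gt0 k0 (etrans (unitmx_inv A) uA) pV.
rewrite /shape_transform; set c := _ / \tr (invmx A *m _ *m _) in c0 *.
have -> : A *m (c *: (invmx A *m V *m (invmx A)^T)) *m A^T = c *: V.
  rewrite -scalemxAr -scalemxAl -!mulmxA -trmx_mul mulmxV // trmx1 mulmx1.
  by rewrite mulmxA mulmxV // mul1mx.
rewrite mxtraceZ trV scalerA mulrAC [k%:R * c]mulrC mulfV ?scale1r //.
by rewrite mulf_neq0 // gt_eqF.
Qed.

End shape.

(** * Equivariance of the spatial signs *)

Lemma enorm_dotE (R : realType) (n : nat) (x : 'cV[R]_n) :
  enorm x = Num.sqrt ((x^T *m x) 0 0).
Proof.
by rewrite mxE; congr Num.sqrt; apply: eq_bigr => i _; rewrite mxE expr2.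
Qed.

Lemma enorm_similitude (R : realType) (n : nat) (M : 'M[R]_n) (x : 'cV[R]_n)
    (a : R) :
  0 <= a -> M^T *m M = (a ^+ 2)%:M -> enorm (M *m x) = a * enorm x.
Proof.
move=> a0 MM; rewrite !enorm_dotE trmx_mul -mulmxA (mulmxA M^T) MM.
rewrite mul_scalar_mx -scalemxAr mxE sqrtrM ?sqr_ge0 //.
by rewrite sqrtr_sqr ger0_norm.
Qed.

(** The orthogonal matrix [Q] depends on [A] and [V] only, not on the
    point [x]. *)
Lemma Usign_equivariant (R : realType) (k : nat) (A V : 'M[R]_k)
    (theta b : 'cV[R]_k) : A \in unitmx -> posdefmx V ->
  exists2 Q : 'M[R]_k, Q *m Q^T = 1%:M & forall x : 'cV[R]_k,
    Usign (A *m theta + b) (shape_transform A V) (A *m x + b) =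
    Q *m Usign theta V x.
Proof.
move=> uA pV.
(* In dimension 0 the factor [k / tr (A V A^T)] is 0 / 0, but there is only
   one vector. *)
have [k0|] := ltnP 0 k; last first.
  case: k A V theta b uA pV => // A V theta b *; exists 1%:M => [|x].
    by rewrite trmx1 mulmx1.
  by rewrite [LHS]flatmx0 [RHS]flatmx0.
set VA := shape_transform A V.
have pVA : posdefmx VA by exact: shape_transform_posdef.
have c0 := shape_transform_factor_gt0 k0 uA pV.
have [pB1 B1V] := sqrtmxP pV; have [pB2 B2V] := sqrtmxP pVA.
have uB1 := posdefmx_unit pB1; have uB2 := posdefmx_unit pB2.
rewrite /Usign; set B1 := sqrtmx V in pB1 B1V uB1 *.
set B2 := sqrtmx VA in pB2 B2V uB2 *.
pose c := k%:R / \tr (A *m V *m A^T); rewrite -/c in c0.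
pose s := Num.sqrt c; have s0 : 0 < s by rewrite sqrtr_gt0.
have s2 : s ^+ 2 = c by rewrite sqr_sqrtr // ltW.
pose M := invmx B2 *m A *m B1.
have trZ : (s *: M)^T = s *: M^T by rewrite linearZ.
have Q1 : (s *: M) *m (s *: M)^T = 1%:M.
  rewrite trZ -scalemxAl -scalemxAr scalerA -expr2 s2 /M.
  rewrite !trmx_mul trmx_inv (posdefmx_sym pB1) (posdefmx_sym pB2).
  have -> : invmx B2 *m A *m B1 *m (B1 *m (A^T *m invmx B2)) =
            invmx B2 *m (A *m V *m A^T) *m invmx B2 by rewrite -B1V !mulmxA.
  rewrite scalemxAl scalemxAr -/(shape_transform A V) -/VA -B2V.
  by rewrite mulKmx // mulmxV.
exists (s *: M) => // x.
have -> : (A *m x + b == A *m theta + b) = (x == theta).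
  by rewrite (inj_eq (addIr b)) (inj_eq (can_inj (mulKmx uA))).
case: eqP => _; first by rewrite mulmx0.
have -> : A *m x + b - (A *m theta + b) = A *m (x - theta).
  by rewrite mulmxBr opprD addrACA subrr addr0.
set y := invmx B1 *m _.
have -> : invmx B2 *m (A *m (x - theta)) = M *m y.
  by rewrite /M /y -!mulmxA mulKVmx.
have -> : enorm (M *m y) = s^-1 * enorm y.
  apply: enorm_similitude; first by rewrite invr_ge0 ltW.
  move/mulmx1C: Q1; rewrite trZ -scalemxAl -scalemxAr scalerA -expr2.
  move=> /(canRL (scalerK _)) ->; first by rewrite exprVn scalemx1.
  by rewrite expf_neq0 // gt_eqF.
by rewrite -scalemxAl -scalemxAr scalerA invfM invrK.
Qed.

(** * Rotations of the half-space directions *)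

Section rotation.
Variables (R : realType) (k : nat).
Implicit Types (N S Q : 'M[R]_k) (u w : 'cV[R]_(k * k)).

(** The inverse of the column stacking map. *)
Definition unvec_cols u : 'M[R]_k := (vec_mx u^T)^T.

Lemma unvec_colsK u : vec_cols (unvec_cols u) = u.
Proof. by rewrite /vec_cols /unvec_cols trmxK vec_mxK trmxK. Qed.

Lemma vec_colsK S : unvec_cols (vec_cols S) = S.
Proof. by rewrite /vec_cols /unvec_cols trmxK mxvecK trmxK. Qed.

Lemma dot_vec_cols N S :
  ((vec_cols N)^T *m vec_cols S) 0 0 = \tr (N^T *m S).
Proof.
rewrite /vec_cols trmxK mxE /mxtrace.
under [RHS]eq_bigr do rewrite mxE.
rewrite (reindex _ (curry_mxvec_bij _ _)) /= pair_bigA /=.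
by apply: eq_bigr => -[i j] _; rewrite mxE !mxvecE !mxE.
Qed.

(** The conjugation [N |-> Q N Q^T], as a map on stacked columns. *)
Definition conj_cols Q u := vec_cols (Q *m unvec_cols u *m Q^T).

Lemma conj_colsK Q : Q^T *m Q = 1%:M -> cancel (conj_cols Q) (conj_cols Q^T).
Proof.
move=> QQ u; rewrite /conj_cols vec_colsK trmxK !mulmxA QQ mul1mx.
by rewrite -mulmxA QQ mulmx1 unvec_colsK.
Qed.

Lemma dot_conj_cols Q u w : Q^T *m Q = 1%:M ->
  ((conj_cols Q u)^T *m conj_cols Q w) 0 0 = (u^T *m w) 0 0.
Proof.
move=> QQ; rewrite -[u in RHS]unvec_colsK -[w in RHS]unvec_colsK !dot_vec_cols.
rewrite !trmx_mul trmxK -!mulmxA (mulmxA Q^T Q) QQ mul1mx mxtrace_mulC.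
by rewrite -!mulmxA QQ mulmx1.
Qed.

Lemma enorm_conj_cols Q u : Q^T *m Q = 1%:M ->
  enorm (conj_cols Q u) = enorm u.
Proof. by move=> QQ; rewrite !enorm_dotE dot_conj_cols. Qed.

Lemma Wvec_equivariant (A V : 'M[R]_k) (theta b : 'cV[R]_k) :
  A \in unitmx -> posdefmx V ->
  exists2 Q : 'M[R]_k, Q *m Q^T = 1%:M & forall x : 'cV[R]_k,
    Wvec (A *m theta + b) (shape_transform A V) (A *m x + b) =
    conj_cols Q (Wvec theta V x).
Proof.
move=> uA pV; have [Q Q1 UE] := Usign_equivariant theta b uA pV.
exists Q => // x; rewrite /Wvec /conj_cols vec_colsK UE; congr vec_cols.
rewrite mulmxBr mulmxBl trmx_mul !mulmxA; congr (_ - _).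
by rewrite mul_mx_scalar -scalemxAl Q1 scalemx1.
Qed.

End rotation.

(** * Invariance of the depth *)

Lemma depth_equivariant (R : realType) (k : nat)
    (d : measure_display) (Omega : measurableType d) (Pr : probability Omega R)
    (X : {RV Pr >-> Rvec R k}) (theta : 'cV[R]_k) (V A : 'M[R]_k)
    (b : 'cV[R]_k) : posdefmx V -> A \in unitmx ->
  depth (A *m theta + b) (shape_transform A V)
      (distribution Pr (affine A b \o X : {RV Pr >-> Rvec R k}))
    = depth theta V (distribution Pr X).
Proof.
move=> pV uA; have [Q QQt WE] := Wvec_equivariant theta b uA pV.
have QtQ := mulmx1C QQt.
(* Rotating the direction by [Q] compensates the rotation of [Wvec]. *)
have half u : distribution Pr (affine A b \o X : {RV Pr >-> Rvec R k})
    [set y : Rvec R k | 0 <= ((conj_cols Q u)^T *m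
      Wvec (A *m theta + b) (shape_transform A V) y) 0 0] =
  distribution Pr X [set x : Rvec R k | 0 <= (u^T *m Wvec theta V x) 0 0].
  apply: (congr1 (fun E : set Omega => Pr E)); apply/funext => w.
  by rewrite /preimage /= /affine WE dot_conj_cols.
apply: (congr1 (fun E : set (\bar R) => ereal_inf E)).
apply/seteqP; split => _ [u Su <-].
  have uE : conj_cols Q (conj_cols Q^T u) = u.
    by rewrite -[Q in conj_cols Q]trmxK conj_colsK // trmxK.
  exists (conj_cols Q^T u).
    by rewrite /unit_sphere /= -(enorm_conj_cols _ QtQ) uE.
  have := half (conj_cols Q^T u); rewrite uE => halfu.
  exact: (esym halfu).
exists (conj_cols Q u); last exact: half.
by rewrite /unit_sphere /= (enorm_conj_cols _ QtQ).
Qed.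

Theorem theorem3p6 (R : realType) (k : nat)
    (d : measure_display) (Omega : measurableType d) (Pr : probability Omega R)
    (X : {RV Pr >-> Rvec R k}) (theta : 'cV[R]_k)
    (V : 'M[R]_k) (hV : shape_matrices V)
    (A : 'M[R]_k) (hA : A \in unitmx) (b : 'cV[R]_k) (alpha : R) :
  depth (A *m theta + b) (shape_transform A V)
      (distribution Pr (affine A b \o X : {RV Pr >-> Rvec R k}))
    = depth theta V (distribution Pr X)
  /\
  depth_region (A *m theta + b) alpha
      (distribution Pr (affine A b \o X : {RV Pr >-> Rvec R k}))
    = [set shape_transform A V' | V' in depth_region theta alpha (distribution Pr X)].
Proof.
split; first by apply: depth_equivariant => //; case: hV.
apply/seteqP; split => [W [sW aW]|_ [V' [sV' aV'] <-]].
  have uA' : invmx A \in unitmx by rewrite unitmx_inv.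
  have sV' := shape_transform_shape uA' sW.
  exists (shape_transform (invmx A) W); last exact: shape_transformVK.
  split; first exact: sV'.
  have dE := depth_equivariant X theta b sV'.1 hA.
  rewrite (shape_transformVK hA sW) in dE.
  exact: (etrans (congr1 (fun e : \bar R => (alpha%:E <= e)%E) (esym dE)) aW).
split; first exact: shape_transform_shape.
have dE := depth_equivariant X theta b sV'.1 hA.
exact: (etrans (congr1 (fun e : \bar R => (alpha%:E <= e)%E) dE) aV').
Qed.
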